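(* Let $m\ge 2$ and let $n\ge 2$ be even, and let $G_{m,n}=S_m\Box P_n$ be the stacked-book graph. Then $$im(G_{m,n}) \ge \begin{cases} m\left\lceil \frac{n}{4}\right\rceil - 1 & \text{if } n\equiv 2 \pmod 4,\\[2pt] \frac{mn}{4} & \text{if } n\equiv 0 \pmod 4.\end{cases}$$
   Context: $S_m$ is the star graph with one central vertex and $m-1$ leaves ($m$ vertices in total); $P_n$ is the path on $n$ vertices. The stacked-book graph $G_{m,n}=S_m\Box P_n$ consists of $n$ copies $S_m(1),\dots,S_m(n)$ of $S_m$, with each vertex of $S_m(i)$ joined to the corresponding vertex of $S_m(i+1)$ for $i\in[1,n-1]$. An induced matching of a graph $G$ is a set $M$ of edges such that no two edges of $M$ share an endpoint and no edge of $G$ joins an endpoint of one edge of $M$ to an endpoint of another edge of $M$; $im(G)$ is the maximum size of an induced matching of $G$. *)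

(* Defs.v *)
From mathcomp Require Import all_boot all_order all_algebra.
Set Implicit Arguments.
Unset Strict Implicit.
Unset Printing Implicit Defensive.

(* A finite simple graph is a symmetric irreflexive relation on a finType. *)

(* The central vertex is the ordinal 0; the other m - 1 ordinals are leaves. *)
Definition star (m : nat) : rel 'I_m :=
  fun i j => (i != j) && ((i == 0 :> nat) || (j == 0 :> nat)).

Definition path_graph (n : nat) : rel 'I_n :=
  fun i j => (i.+1 == j :> nat) || (j.+1 == i :> nat).

Definition cartesian_product (T U : finType) (e : rel T) (f : rel U) :
    rel (T * U)%type :=
  fun x y => (x.1 == y.1) && f x.2 y.2 || (x.2 == y.2) && e x.1 y.1.

(* The i-th copy of the star is the set of vertices with second component i. *)
Definition stacked_book (m n : nat) : rel ('I_m * 'I_n)%type :=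
  cartesian_product (@star m) (@path_graph n).
Arguments stacked_book : clear implicits.

Lemma stacked_book_sym m n : symmetric (stacked_book m n).
Proof.
move=> [i k] [j l]; rewrite /stacked_book /cartesian_product /star /path_graph /=.
by rewrite ![j == i]eq_sym ![l == k]eq_sym orbC [in RHS]orbC
  [(l.+1 == k) || _]orbC [(j == 0 :> nat) || _]orbC.
Qed.

Lemma stacked_book_irrefl m n : irreflexive (stacked_book m n).
Proof.
move=> [i k]; rewrite /stacked_book /cartesian_product /star /path_graph /=.
by rewrite !eqxx /= -[X in _.+1 == X]addn0 -addn1 eqn_add2l.
Qed.

(* Edges are unordered pairs, so the size of a matching is its number of
   undirected edges. *)
Definition edges (T : finType) (e : rel T) : {set {set T}} :=
  [set [set x; y] | x in T, y in T & e x y].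

Definition matching (T : finType) (e : rel T) (M : {set {set T}}) : bool :=
  (M \subset edges e) &&
  [forall A in M, forall B in M, (A != B) ==> [disjoint A & B]].

Definition induced_matching (T : finType) (e : rel T) (M : {set {set T}}) :
    bool :=
  matching e M &&
  [forall A in M, forall B in M, (A != B) ==>
     [forall x in A, forall y in B, ~~ e x y]].

Definition im (T : finType) (e : rel T) : nat :=
  \max_(M : {set {set T}} | induced_matching e M) #|M|.

(* Main.v *)
(** Cut the path into [n / 2] blocks of two consecutive columns.  In the blocks
    of even index take the [m - 1] edges that join the two copies of each leaf,
    in the blocks of odd index only the edge that joins the two copies of the
    centre.  A leaf edge and a centre edge differ in both coordinates, two leaf
    edges of different rows are not adjacent since leaves are not, and two
    edges of the same row lie at least two columns apart. *)
Require Import Defs.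
From mathcomp Require Import all_boot all_order all_algebra.
From mathcomp Require Import zify lra.
Import Order.TTheory GRing.Theory Num.Theory.
Local Open Scope ring_scope.

(** One separation condition does three jobs: the case [x == y] makes distinct edges disjoint, the
    case [e x y] makes the matching induced, and taking [x = y = u i] shows that distinct indices
    give distinct edges, so that counting indices counts edges. *)
Lemma leq_card_im (T I : finType) (e : rel T) (P : {set I}) (u v : I -> T) :
    (forall i, i \in P -> e (u i) (v i)) ->
    (forall i j x y, i \in P -> j \in P ->
       x \in [set u i; v i] -> y \in [set u j; v j] ->
       (x == y) || e x y -> i = j) ->
  (#|P| <= im e)%N.
Proof.
move=> euv sep; pose E i := [set u i; v i].
have uE i : u i \in E i by rewrite set21.
have injE : {in P &, injective E}.
  move=> i j iP jP eqE; apply: (sep i j (u i) (u i)) => //; last by rewrite eqxx.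
  by have := uE i; rewrite eqE.
rewrite -(card_in_imset injE).
apply: (@leq_bigmax_cond _ _ (fun M : {set {set T}} => #|M|)).
rewrite /induced_matching /matching -andbA; apply/and3P; split.
- apply/subsetP => _ /imsetP[i iP ->]; apply/imset2P.
  by exists (u i) (v i) => //; rewrite inE /= euv.
- apply/forall_inP => _ /imsetP[i iP ->]; apply/forall_inP => _ /imsetP[j jP ->].
  apply/implyP => neqE; apply/pred0P => x /=; apply: contra_neqF neqE.
  by case/andP=> xi xj; rewrite (sep i j x x) ?eqxx.
apply/forall_inP => _ /imsetP[i iP ->]; apply/forall_inP => _ /imsetP[j jP ->].
apply/implyP => neqE; apply/forall_inP => x xi; apply/forall_inP => y yj.
by apply: contra_neqN neqE => exy; rewrite (sep i j x y) ?exy ?orbT.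
Qed.

Lemma block_col_subproof (k : nat) (t : 'I_k) (b : bool) : (b + t.*2 < k.*2)%N.
Proof. by case: b; have := ltn_ord t; lia. Qed.

Definition block_col (k : nat) (b : bool) (t : 'I_k) : 'I_k.*2 :=
  Ordinal (block_col_subproof k t b).

Definition block_rungs (m k : nat) : {set 'I_m * 'I_k} :=
  [set p : 'I_m * 'I_k | (p.1 == 0 :> nat) == odd p.2].

(** Count block by block: each of the [uphalf k] even blocks contributes its [m] leaves, each of the
    [k./2] odd ones a single centre. *)
Lemma card_block_rungs (m k : nat) :
  #|block_rungs m.+1 k| = (uphalf k * m + k./2)%N.
Proof.
have row_card (t : 'I_k) :
    (\sum_(i < m.+1 | (i == 0 :> nat) == odd t) 1 = if odd t then 1 else m)%N.
  rewrite big_mkcond big_ord_recl /=; case: (odd t) => /=.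
    by rewrite big1.
  by rewrite sum1_card card_ord.
rewrite -sum1_card.
transitivity (\sum_(t < k) \sum_(i < m.+1 | (i == 0 :> nat) == odd t) 1)%N.
  rewrite (exchange_big_dep xpredT) //= pair_big_dep.
  by apply: eq_bigl => p; rewrite inE.
rewrite (eq_bigr _ (fun t _ => row_card t)) {row_card}.
elim: k => [|k IHk]; first by rewrite big_ord0.
by rewrite big_ord_recr /= IHk uphalf_half; case: (odd k); lia.
Qed.

Lemma im_stacked_book_ge (m k : nat) :
  (uphalf k * m + k./2 <= im (stacked_book m.+1 k.*2))%N.
Proof.
rewrite -card_block_rungs.
pose u b (p : 'I_m.+1 * 'I_k) := (p.1, block_col k b p.2).
apply: (@leq_card_im _ _ _ _ (u false) (u true)) => [[i t] _|].
  by rewrite /stacked_book /cartesian_product /path_graph /= !eqxx.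
move=> [i s] [j t] x y; rewrite !inE /= => si tj xs yt xy.
have [b Dx] : exists b, x = u b (i, s) by case/orP: xs => /eqP; eexists; eauto.
have [c Dy] : exists c, y = u c (j, t) by case/orP: yt => /eqP; eexists; eauto.
rewrite {x xs}Dx {y yt}Dy in xy; move: xy.
rewrite /stacked_book /cartesian_product /star /path_graph /u.
rewrite xpair_eqE /= -!(inj_eq val_inj) /= => xy.
suff [eij est] : i = j :> nat /\ s = t :> nat by congr pair; apply: val_inj.
(* In a common row, [si] and [tj] give [s] and [t] the same parity, while the columns differ by at
   most one, so [s = t]. In a common column [s = t] at once, and the same parities rule out a centre
   next to a leaf. *)
by case: b c xy => [] [] /=; lia.
Qed.

Theorem theorem9 (m n : nat) (hm : (2 <= m)%N) (hn : (2 <= n)%N)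
  (n_even : ~~ odd n) :
  (n = 2 %[mod 4] ->
     (m%:Z * Num.ceil (n%:R / 4%:R : rat) - 1 <= (im (stacked_book m n))%:Z :> int))
  /\
  (n = 0 %[mod 4] ->
     ((m * n)%N%:R / 4%:R <= (im (stacked_book m n))%:R :> rat)).
Proof.
case: m hm => // m _.
have Dn : n = n./2.*2 by lia.
have := im_stacked_book_ge m n./2; rewrite -Dn.
move: (im _) => N leN; split=> n_mod.
  have Dq : n = (4 * (n %/ 4) + 2)%N by lia.
  set q := (n %/ 4)%N in Dq.
  have -> : Num.ceil (n%:R / 4%:R : rat) = q.+1%:Z.
    apply: Num.Theory.ceil_def.
    by rewrite Dq natrD natrM; apply/andP; split; lra.
  (* There are [2 * q + 1] blocks, and [q.+1 * m + q = m.+1 * q.+1 - 1]. *)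
  have [eq1 eq2] : uphalf n./2 = q.+1 /\ (n./2)./2 = q by lia.
  by rewrite eq1 eq2 in leN; nia.
have Dq : n = (4 * (n %/ 4))%N by lia.
set q := (n %/ 4)%N in Dq.
have [eq1 eq2] : uphalf n./2 = q /\ (n./2)./2 = q by lia.
rewrite eq1 eq2 in leN.
rewrite ler_pdivrMr // -natrM ler_nat Dq; nia.
Qed.
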